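(* Let $L\ge 1$ and $M\ge 3$ be integers. Suppose $y(t)=x(t)+n(t)$, $t=0,\dots,LM-1$, is divided into $M$ windows of length $L$, where $x(t)$ is a deterministic (real- or complex-valued) $L$-periodic signal and $n(t)$ is a length $LM$ sequence of i.i.d. real Gaussian random variables with mean zero and variance $\sigma^2$ ($\sigma\ge 0$). Let $f\in\{0,\dots,L-1\}$ with $f\neq 0$ and $f\neq L/2$. Then $$\mathbb{E}|P_y(f)|-|X(f)|^2\le \sigma\sqrt{\pi}\,|X(f)|+\frac{\sigma^2}{\sqrt{2M}},$$ where $P_y$ is the cross-correlation periodogram of $y$ and $X$ is the normalized discrete Fourier transform of one period of $x$.
   Context: $L$-periodic means $x(t+L)=x(t)$ for all $t$. $X(f)=\frac{1}{\sqrt L}\sum_{t=0}^{L-1}x(t)e^{-2\pi i f t/L}$ for $f=0,\dots,L-1$. The $m$-th noise window is $n_m(t):=n(mL+t)$, $t=0,\dots,L-1$, $m=0,\dots,M-1$, with transform $N_m(f)=\frac{1}{\sqrt L}\sum_{t=0}^{L-1}n_m(t)e^{-2\pi i f t/L}$. The transform (with the same normalization) of the $m$-th window of $y$ is $Y_m(f)=X(f)+N_m(f)$. The cross-correlation periodogram of $y$ is $P_y(f)=\frac1M\sum_{m=0}^{M-1}\mathrm{Re}\big[Y_m(f)\,Y_{m+1}(f)^*\big]$, where $*$ denotes complex conjugation and window indices are taken modulo $M$ (so $Y_M=Y_0$). *)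

(* Defs.v *)
From HB Require Import structures.
From mathcomp Require Import all_boot all_order all_algebra.
From mathcomp Require Import complex.
From mathcomp Require Import all_classical all_reals all_analysis.

Set Implicit Arguments.
Unset Strict Implicit.
Unset Printing Implicit Defensive.

Import Order.TTheory GRing.Theory Num.Theory.
Import numFieldNormedType.Exports.

Local Open Scope classical_set_scope.
Local Open Scope ring_scope.
Local Open Scope complex_scope.

(* The real-valued modulus; the library norm `|z| lives in R[i] itself. *)
Definition cmod (R : realType) (z : R[i]) : R := ComplexField.Normc.normc z.

(* $e^{ia}$ for real $a$ *)
Definition expi (R : realType) (a : R) : R[i] := cos a +i* sin a.

Definition dft (R : realType) (L : nat) (u : 'I_L -> R[i]) (f : 'I_L) : R[i] :=
  ((Num.sqrt L%:R)^-1)%:C *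
  \sum_(t < L) u t * expi (- (2 * pi * f%:R * t%:R / L%:R)).

Lemma window_index_subproof (L M : nat) (m : 'I_M) (t : 'I_L) :
  (m * L + t < L * M)%N.
Proof.
rewrite mulnC; apply: (@leq_trans (L * m.+1)); last by rewrite leq_mul2l ltn_ord orbT.
by rewrite mulnS addnC ltn_add2r.
Qed.

Definition window_index (L M : nat) (m : 'I_M) (t : 'I_L) : 'I_(L * M) :=
  Ordinal (window_index_subproof m t).

Definition window (C : Type) (L M : nat) (s : 'I_(L * M) -> C) (m : 'I_M)
  : 'I_L -> C := fun t => s (window_index m t).

(* [ordS] is the successor modulo M, so the last window is paired with the
   first one. *)
Definition cross_periodogram (R : realType) (L M : nat)
    (y : 'I_(L * M) -> R[i]) (f : 'I_L) : R :=
  M%:R^-1 *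
  \sum_(m < M) complex.Re (dft (window y m) f * (dft (window y (ordS m)) f)^*).

(* The normal law with mean m and standard deviation s.  The library's
   [normal_prob m 0] is the uniform law on [0, 1], so the degenerate case
   has to be set to the Dirac mass at m. *)
Definition gaussian_law (R : realType) (m s : R) (A : set R) : \bar R :=
  if s == 0 then \d_m A else normal_prob m s A.

Definition mutually_independent (d : measure_display) (T : measurableType d)
    (R : realType) (P : probability T R) (I : finType)
    (X : I -> {RV P >-> R}) : Prop :=
  forall (J : {set I}) (B : I -> set R),
    (forall i, i \in J -> measurable (B i)) ->
    P (\bigcap_(i in [set` J]) (X i @^-1` B i)) =
    (\prod_(i in J) P (X i @^-1` B i))%E.

Definition iid_gaussian (d : measure_display) (T : measurableType d)
    (R : realType) (P : probability T R) (I : finType)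
    (X : I -> {RV P >-> R}) (m s : R) : Prop :=
  mutually_independent X /\
  forall (i : I) (A : set R), measurable A ->
    distribution P (X i) A = gaussian_law m s A.

(* Main.v *)
Require Import Defs.
From HB Require Import structures.
From mathcomp Require Import all_boot all_order all_algebra.
From mathcomp Require Import complex.
From mathcomp Require Import all_classical all_reals all_analysis.
From mathcomp Require Import measurable_realfun.
From mathcomp Require Import ring lra zify.

(** Write X for the transform of one period of the signal and N_m for that of
the m-th noise window, so that the m-th window of y has transform X + N_m.
Expanding the products gives P_y = |X|^2 + lin + quad, where
lin = (2/M) Re (X^* sum_m N_m) is a linear form in the noise samples and
quad = (1/M) sum_m Re (N_m N_(m+1)^* ) is a quadratic form
([cross_periodogram_decomposition]). The triangle inequality leaves E|lin| and
E|quad|, and each is at most the root of the corresponding second moment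
([integral_norm_le]).

Both second moments are sums of squares. In lin the samples themselves are
pairwise orthogonal; in quad the products n_i n_j, with i and j in consecutive
windows, are pairwise orthogonal as well, because for M >= 3 different index
triples (m, s, t) yield different unordered pairs {i, j}, and then one sample
occurs exactly once in n_i n_j n_k n_l ([has_mean_mul_pairs]). Hence
[integral_norm_orthogonal_sum_le] reduces the problem to sums of squared
coefficients. At the admitted frequencies the real and imaginary parts of the
Fourier vector (e^(-2 pi i f t / L) / sqrt L)_t are orthogonal and both have
squared norm 1/2 ([sum_dft_re_sqr], [sum_dft_im_sqr], [sum_dft_re_im]); f = 0 and
f = L/2 are excluded because the imaginary part vanishes there. This gives
E lin^2 <= 2 sigma^2 |X|^2 / M and E quad^2 <= sigma^4 / (2 M). The second bound
is the required one, and the first suffices since 2 / M <= pi.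

The Gaussian law enters only through its mean 0 and the bound sigma^2 on its
second moment ([gaussian_has_mean0], [gaussian_has_second_moment]).
Independence enters through the product rule for expectations
([has_mean_prod_independent]), obtained from the product rule for events by
replacing indicators with nonnegative functions and these with signed ones, one
factor at a time. *)

Set Implicit Arguments.
Unset Strict Implicit.
Unset Printing Implicit Defensive.

Import Order.TTheory GRing.Theory Num.Theory.
Import numFieldNormedType.Exports.

Local Open Scope classical_set_scope.
Local Open Scope ring_scope.
Local Open Scope complex_scope.

(** * Integration against a weighted push-forward *)

Section density.
Local Open Scope ereal_scope.
Context d1 d2 (X : measurableType d1) (Y : measurableType d2) (R : realType).
Variables (mu : {measure set X -> \bar R}) (nu : {measure set Y -> \bar R}).
Variables (phi : X -> Y) (h : X -> R).
Hypotheses (mphi : measurable_fun setT phi) (mh : measurable_fun setT h).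
Hypothesis h0 : forall x, (0 <= h x)%R.
Hypothesis nuE : forall B, measurable B ->
  nu B = \int[mu]_(x in phi @^-1` B) (h x)%:E.

Import HBNNSimple.

Let measurable_weighted (g : Y -> R) : measurable_fun setT g ->
  measurable_fun setT (fun x => (g (phi x) * h x)%R).
Proof.
move=> mg; apply: measurable_funM => //.
exact: measurableT_comp mg mphi.
Qed.

Let integral_indic_weighted B : measurable B ->
  \int[nu]_y (\1_B y)%:E = \int[mu]_x (\1_B (phi x) * h x)%:E.
Proof.
move=> mB; rewrite integral_indic// setIT nuE//.
have mphiB : measurable (phi @^-1` B).
  by rewrite -[X in measurable X]setTI; exact: mphi.
rewrite integral_mkcond; apply: eq_integral => x _.
by rewrite epatch_indic/= muleC -EFinM !indicE.
Qed.

Let integral_nnsfun_weighted (g : {nnsfun Y >-> R}) :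
  \int[nu]_y (g y)%:E = \int[mu]_x (g (phi x) * h x)%:E.
Proof.
under eq_integral do rewrite fimfunE -fsumEFin//.
rewrite ge0_integral_fsum//; last 2 first.
- by move=> r; exact/measurable_EFinP/measurable_funM.
- by move=> r y _; rewrite EFinM nnfun_muleindic_ge0.
under [RHS]eq_integral.
  move=> x _; rewrite fimfunE EFinM -fsumEFin// muleC.
  rewrite ge0_mule_fsumr; last by move=> r; rewrite EFinM nnfun_muleindic_ge0.
  over.
rewrite [RHS]ge0_integral_fsum//; last 2 first.
- move=> r; under eq_fun do rewrite -EFinM mulrC.
  apply/measurable_EFinP.
  apply: (@measurable_weighted (fun y => r * \1_(g @^-1` [set r]) y)%R).
  exact: measurable_funM.
- by move=> r x _; rewrite mule_ge0 ?lee_fin// -lee_fin EFinM nnfun_muleindic_ge0.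
apply: eq_fsbigr => r _; rewrite integralZl_indic_nnsfun//=.
have [r0|r0] := ltP r 0%R.
  rewrite preimage_nnfun0// integral0_eq ?mule0 ?integral0_eq// => x _.
    by rewrite indic0 mulr0 mule0.
  by rewrite indic0.
rewrite integral_indic_weighted// -ge0_integralZl//; last 2 first.
- by apply/measurable_EFinP/(@measurable_weighted (\1_(g @^-1` [set r]))).
- by move=> x _; rewrite lee_fin mulr_ge0.
by apply: eq_integral => x _; rewrite -!EFinM mulrA mulrC.
Qed.

(** Change of variables for a measure given by a density after pushing forward.
It serves twice: with the identity map, to integrate against a normal density,
and with a random variable as the map and a product of other random variables
as the density, to pull one factor out of an expectation. *)
Lemma ge0_integral_weighted (g : Y -> R) : measurable_fun setT g ->
  (forall y, (0 <= g y)%R) ->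
  \int[nu]_y (g y)%:E = \int[mu]_x (g (phi x) * h x)%:E.
Proof.
move=> mg g0.
have mEg : measurable_fun setT (EFin \o g) by exact/measurable_EFinP.
pose f_ := nnsfun_approx measurableT mEg.
have f_cvg y : (EFin \o f_^~ y) n @[n --> \oo] --> (g y)%:E.
  by apply: (cvg_nnsfun_approx measurableT mEg) => // z _; rewrite lee_fin.
transitivity (limn (fun n => \int[nu]_y (f_ n y)%:E)).
  rewrite -monotone_convergence//=.
  - apply: eq_integral => y _; apply/esym/cvg_lim => //; exact: f_cvg.
  - by move=> n; apply/measurable_EFinP.
  - by move=> n y _; rewrite lee_fin.
  - by move=> y _ a b ab; rewrite lee_fin; exact/lefP/nd_nnsfun_approx.
under eq_fun do rewrite integral_nnsfun_weighted.
rewrite -monotone_convergence//=.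
- apply: eq_integral => x _; apply/cvg_lim => //.
  rewrite EFinM; under eq_fun do rewrite EFinM.
  by apply: cvgeZr => //; exact: f_cvg.
- by move=> n; exact/measurable_EFinP/measurable_weighted.
- by move=> n x _; rewrite lee_fin mulr_ge0.
- move=> x _ a b ab; rewrite lee_fin ler_wpM2r//; exact/lefP/nd_nnsfun_approx.
Qed.

End density.

(** * Expectations of products of independent variables *)

Section has_mean.
Local Open Scope ereal_scope.
Context d (T : measurableType d) (R : realType) (P : probability T R).
Implicit Types (Z U : T -> R) (b c : R).

(** Integrability and the value of the expectation are carried together, as a
real number, so that expectations can be added and multiplied without side
conditions on extended reals. *)
Definition has_mean Z c : Prop :=
  P.-integrable setT (EFin \o Z) /\ \int[P]_w (Z w)%:E = c%:E.

Lemma has_mean_measurable Z c : has_mean Z c -> measurable_fun setT Z.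
Proof. by move=> [/measurable_int/measurable_EFinP]. Qed.

Lemma has_meanE Z c c' : has_mean Z c -> has_mean Z c' -> c = c'.
Proof. by move=> [_ h] [_]; rewrite h => -[]. Qed.

Lemma integrable_has_mean Z :
  P.-integrable setT (EFin \o Z) -> {c | has_mean Z c}.
Proof.
move=> iZ; exists (fine (\int[P]_w (Z w)%:E)); split=> //.
by rewrite fineK// (integrable_fin_num _ iZ).
Qed.

Lemma ge0_has_mean Z c : measurable_fun setT Z -> (forall w, (0 <= Z w)%R) ->
  \int[P]_w (Z w)%:E = c%:E -> has_mean Z c.
Proof.
move=> mZ Z0 Zc; split=> //; apply/integrableP.
split; first exact/measurable_EFinP.
under eq_integral do rewrite /= ger0_norm//.
by rewrite Zc ltry.
Qed.

Lemma has_mean_indic A : measurable A -> has_mean \1_A (fine (P A)).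
Proof.
move=> mA; apply: ge0_has_mean => //.
by rewrite integral_indic// setIT fineK// fin_num_measure.
Qed.

Lemma has_mean_cst c : has_mean (fun=> c) c.
Proof.
split; first exact: finite_measure_integrable_cst.
by rewrite integral_cst//= probability_setT mule1.
Qed.

Lemma has_meanD Z1 Z2 c1 c2 : has_mean Z1 c1 -> has_mean Z2 c2 ->
  has_mean (fun w => Z1 w + Z2 w)%R (c1 + c2).
Proof.
move=> [i1 e1] [i2 e2]; split; first exact: (integrableD _ i1 i2).
by under eq_integral do rewrite EFinD; rewrite integralD_EFin//= e1 e2.
Qed.

Lemma has_meanZ Z c a : has_mean Z c -> has_mean (fun w => a * Z w)%R (a * c).
Proof.
move=> [i1 e1]; split; first exact: (integrableZl _ a i1).
by under eq_integral do rewrite EFinM; rewrite integralZl//= e1.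
Qed.

Lemma has_meanB Z1 Z2 c1 c2 : has_mean Z1 c1 -> has_mean Z2 c2 ->
  has_mean (fun w => Z1 w - Z2 w)%R (c1 - c2).
Proof.
move=> h1 /(has_meanZ (- 1)) h2; rewrite -(mulN1r c2).
by under eq_fun do rewrite -(mulN1r (Z2 _)); exact: has_meanD.
Qed.

Lemma has_mean_sum (K : finType) (Z : K -> T -> R) (c : K -> R) :
  (forall k, has_mean (Z k) (c k)) ->
  has_mean (fun w => \sum_k Z k w)%R (\sum_k c k).
Proof.
move=> h; split.
  under [X in integrable _ _ X]eq_fun do rewrite /= -sumEFin.
  by apply: integrable_sum => // k _; exact: (h k).1.
under eq_integral do rewrite -sumEFin.
rewrite integral_sum//; last by move=> k; exact: (h k).1.
by rewrite -sumEFin; apply: eq_bigr => k _; exact: (h k).2.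
Qed.

(** The bound E|U| <= sqrt (E U^2), by integrating
2 b |U| <= U^2 + b^2 for every b larger than a bound on sqrt (E U^2); taking a
larger b avoids the case b = 0. *)
Lemma integral_norm_le U c b : measurable_fun setT U ->
  has_mean (fun w => U w ^+ 2)%R c -> (0 <= b)%R -> (c <= b ^+ 2)%R ->
  \int[P]_w (`|U w|%R)%:E <= b%:E.
Proof.
move=> mU hU b0 cb; apply/lee_addgt0Pr => e e0; rewrite -EFinD.
set b' := (b + e)%R.
have b'0 : (0 < b')%R by rewrite ltr_wpDl.
have bb' : (b ^+ 2 <= b' ^+ 2)%R.
  by rewrite ler_sqr ?nnegrE ?(ltW b'0)// lerDl ltW.
clearbody b'.
have hb : has_mean (fun w => (2 * b')^-1 * U w ^+ 2 + b' / 2)%R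
    ((2 * b')^-1 * c + b' / 2)%R.
  exact: has_meanD (has_meanZ _ hU) (has_mean_cst _).
have scaled z : (2 * b' * ((2 * b')^-1 * z + b' / 2) = z + b' ^+ 2)%R.
  by field; rewrite gt_eqF.
apply: (@le_trans _ _ (\int[P]_w ((2 * b')^-1 * U w ^+ 2 + b' / 2)%:E)).
  apply: ge0_le_integral => //.
  - by apply/measurable_EFinP; exact: measurableT_comp.
  - exact/measurable_EFinP/(has_mean_measurable hb).
  - move=> w _; rewrite lee_fin.
    rewrite -(ler_pM2l (x := (2 * b')%R)) ?mulr_gt0// scaled.
    by have := sqr_ge0 (`|U w| - b')%R; rewrite sqrrB real_normK ?num_real//; lra.
rewrite hb.2 lee_fin -(ler_pM2l (x := (2 * b')%R)) ?mulr_gt0// scaled; lra.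
Qed.

End has_mean.

Section independent_product.
Local Open Scope ereal_scope.
Context d (T : measurableType d) (R : realType) (P : probability T R).
Context (I : finType) (X : I -> {RV P >-> R}).
Hypothesis indX : mutually_independent X.

Definition factorizes (g : I -> R -> R) : Prop := forall m : I -> R,
  (forall i, has_mean P (g i \o X i) (m i)) ->
  has_mean P (fun w => \prod_i g i (X i w))%R (\prod_i m i)%R.

Definition update (V : Type) (g : I -> V) i h : I -> V :=
  fun j => if j == i then h else g j.

(** A property of families that holds when all members lie in a class [K] spreads
to a larger class [K'] as soon as one member at a time can be enlarged, the
others being arbitrary in [K']: the members not yet enlarged are still in [K],
and the induction runs over the list of the enlarged ones. *)
Lemma class_extension (K K' : (R -> R) -> Prop) (Q : (I -> R -> R) -> Prop) :
  (forall h, K h -> K' h) ->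
  (forall g i, (forall j, K' (g j)) ->
    (forall h, K h -> Q (update g i h)) -> Q g) ->
  (forall g, (forall i, K (g i)) -> Q g) ->
  forall g, (forall i, K' (g i)) -> Q g.
Proof.
move=> KK' step base.
suff H (s : seq I) g : (forall i, K' (g i)) ->
    (forall i, i \notin s -> K (g i)) -> Q g.
  by move=> g Kg; apply: (H (enum I)) => // i; rewrite mem_enum.
elim: s g => [|i s IH] g K'g Kg; first by apply: base => i; exact: Kg.
apply: (step _ i) => // h Kh; apply: IH => [j|j js]; rewrite /update.
  by case: eqVneq => // _; exact: KK'.
by case: eqVneq => // ji; apply: Kg; rewrite inE negb_or ji.
Qed.

Let factorizes_indic (g : I -> R -> R) :
  (forall i, exists2 B, measurable B & g i = \1_B) -> factorizes g.
Proof.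
move=> gB m hm; have {}gB i : {B | measurable B & g i = \1_B} by exact/cid2.
pose B i := s2val (gB i).
have mB i : measurable (B i) := s2valP (gB i).
have gE i : g i = \1_(B i) := s2valP' (gB i).
have mXB i : measurable (X i @^-1` B i).
  by rewrite -[Y in measurable Y]setTI; exact: (measurable_funP (X i)).
have mE i : m i = fine (P (X i @^-1` B i)).
  apply: has_meanE (hm i) _; rewrite gE.
  exact: (has_mean_indic P (mXB i)).
pose E := \bigcap_(i in [set` [set: I]%SET]) (X i @^-1` B i).
have mE' : measurable E.
  by apply: fin_bigcap_measurable => //; exact: finite_finset.
have -> : (fun w => \prod_i g i (X i w))%R = \1_E :> (T -> R).
  apply/funext => w; under eq_bigr do rewrite gE indicE.
  rewrite indicE; have [h|h] := pselect (E w).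
    rewrite mem_set// big1// => i _; rewrite mem_set//.
    by apply: (h i) => /=; rewrite finset.in_setT.
  rewrite memNset//.
  have [i hi] : exists i, ~ B i (X i w).
    by apply/existsNP => h'; apply: h => i _ /=; exact: h'.
  by rewrite (bigD1 i)//= memNset// mul0r.
have -> : (\prod_i m i)%R =
    fine (P E).
  rewrite indX//; under [in RHS]eq_bigl do rewrite finset.in_setT.
  under [in RHS]eq_bigr => i _ do rewrite -[P _]fineK ?fin_num_measure//.
  by rewrite prodEFin/=; apply: eq_bigr => i _; exact: mE.
exact: has_mean_indic.
Qed.

Let rest (g : I -> R -> R) i (w : T) : R := \prod_(j | j != i) g j (X j w).

Let prod_rest (g : I -> R -> R) i w :
  (\prod_j g j (X j w) = rest g i w * g i (X i w))%R.
Proof. by rewrite (bigD1 i)//= mulrC. Qed.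

Let measurable_rest (g : I -> R -> R) i :
  (forall j, measurable_fun setT (g j)) -> measurable_fun setT (rest g i).
Proof.
move=> mg; rewrite /rest.
under eq_fun do rewrite -big_filter.
by apply: measurable_prod => j _; exact: measurableT_comp.
Qed.

Let factorizes_update (g : I -> R -> R) i (h : R -> R) (m : I -> R) (c : R) :
  factorizes (update g i h) ->
  (forall j, has_mean P (g j \o X j) (m j)) -> has_mean P (h \o X i) c ->
  has_mean P (fun w => rest g i w * h (X i w))%R (\prod_(j | j != i) m j * c)%R.
Proof.
move=> gh hm hc.
have -> : (\prod_(j | j != i) m j * c = \prod_j update m i c j)%R.
  rewrite [RHS](bigD1 i)//= {1}/update eqxx mulrC; congr (_ * _)%R.
  by apply: eq_bigr => j /negbTE ji; rewrite /update ji.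
have : has_mean P (fun w => \prod_j update g i h j (X j w))%R
    (\prod_j update m i c j)%R.
  by apply: gh => j; rewrite /update; case: eqVneq => // ->.
under eq_fun do rewrite (prod_rest _ i) {2}/update eqxx.
have -> : rest (update g i h) i = rest g i.
  apply/funext => w; apply: eq_bigr => j /negbTE ji; by rewrite /update ji.
by [].
Qed.

Let factorizes_ge0 (g : I -> R -> R) :
  (forall i, measurable_fun setT (g i) /\ (forall x, 0 <= g i x)%R) ->
  factorizes g.
Proof.
move: g; apply: (@class_extension (fun h => exists2 B, measurable B & h = \1_B)
  (fun h => measurable_fun setT h /\ (forall x, 0 <= h x)%R) factorizes).
- by move=> _ [B mB ->].
- move=> g i mg0 ind m hm.
  have mg j := (mg0 j).1; have g0 j := (mg0 j).2.
  have rest0 w : (0 <= rest g i w)%R by apply: prodr_ge0 => j _; exact: g0.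
  have m0 j : (0 <= m j)%R.
    by rewrite -lee_fin -(hm j).2; apply: integral_ge0 => w _; rewrite lee_fin g0.
  set c := (\prod_(j | j != i) m j)%R.
  have c0 : (0 <= c)%R by apply: prodr_ge0.
  have mX : measurable_fun setT (X i) by exact: (measurable_funP (X i)).
  (* Weighting P by the other factors and pushing it forward along X i gives a
     multiple of the law of X i, by the case where the factor at i is an
     indicator. *)
  have E : \int[mscale (NngNum c0) (distribution P (X i))]_y (g i y)%:E =
      \int[P]_w (g i (X i w) * rest g i w)%:E.
    apply: ge0_integral_weighted => //; first exact: measurable_rest.
    move=> B mB; have mXB : measurable (X i @^-1` B).
      by rewrite -[Y in measurable Y]setTI; exact: mX.
    have h1 : has_mean P (\1_B \o X i) (fine (P (X i @^-1` B))).
      exact: (has_mean_indic P mXB).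
    have [_] := factorizes_update (ind _ (ex_intro2 _ _ B mB erefl)) hm h1.
    rewrite integral_mkcond epatch_indic -/c => E.
    transitivity (c * fine (P (X i @^-1` B)))%:E.
      by rewrite EFinM fineK// fin_num_measure.
    rewrite -E; apply: eq_integral => w _ /=.
    by rewrite EFinM !indicE.
  apply: ge0_has_mean.
  - by apply: measurable_prod => j _; exact: measurableT_comp.
  - by move=> w; apply: prodr_ge0 => j _; exact: g0.
  - under eq_integral do rewrite (prod_rest _ i) mulrC.
    rewrite -E ge0_integral_mscale//=; last 2 first.
    + exact/measurable_EFinP.
    + by move=> y _; rewrite lee_fin.
    rewrite ge0_integral_distribution/=; last 2 first.
    + exact/measurable_EFinP.
    + by move=> y; rewrite lee_fin.
    by rewrite (hm i).2 -EFinM (bigD1 i)//= mulrC.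
- by move=> g; exact: factorizes_indic.
Qed.

(** Expectations of products of functions of independent variables factorize.
A signed factor is the difference of its positive and negative parts, to which
the nonnegative case applies. *)
Lemma has_mean_prod_independent (g : I -> R -> R) (m : I -> R) :
  (forall i, measurable_fun setT (g i)) ->
  (forall i, has_mean P (g i \o X i) (m i)) ->
  has_mean P (fun w => \prod_i g i (X i w))%R (\prod_i m i)%R.
Proof.
move=> mg; move: g mg m.
apply: (@class_extension (fun h => measurable_fun setT h /\ (forall x, 0 <= h x)%R)
  (fun h => measurable_fun setT h) factorizes).
- by move=> h [].
- move=> g i mg ind m hm.
  have [c1 h1] : {c | has_mean P ((g i)^\+%R \o X i) c}.
    by apply: integrable_has_mean; exact: integrable_funrpos (hm i).1.
  have [c2 h2] : {c | has_mean P ((g i)^\-%R \o X i) c}.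
    by apply: integrable_has_mean; exact: integrable_funrneg (hm i).1.
  have gE x : (g i x = (g i)^\+ x - (g i)^\- x)%R.
    by rewrite -[in LHS](funrposBneg (g i)).
  have mE : (m i = c1 - c2)%R.
    apply: has_meanE (hm i) _.
    rewrite (_ : _ \o _ =
        fun w => (g i)^\+ (X i w) - (g i)^\- (X i w))%R.
      exact: has_meanB h1 h2.
    by apply/funext => w; exact: gE.
  rewrite (bigD1 i)//= mulrC mE mulrBr.
  under eq_fun do rewrite (prod_rest _ i) gE mulrBr.
  apply: has_meanB; apply: factorizes_update => //; apply: ind; split=> //.
  + exact: measurable_funrpos.
  + exact: measurable_funrneg.
- exact: factorizes_ge0.
Qed.

End independent_product.

(** * First two moments of the Gaussian law *)

Section gaussian_moments.
Local Open Scope ereal_scope.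
Context d (T : measurableType d) (R : realType) (P : probability T R).
Variables (X : {RV P >-> R}) (sigma : R).
Hypothesis sigma0 : (0 <= sigma)%R.
Hypothesis lawX : forall A, measurable A ->
  distribution P X A = gaussian_law 0 sigma A.

Local Notation mu := (@lebesgue_measure R).

Let ge0_integral_dirac (g : R -> R) : sigma = 0%R -> measurable_fun setT g ->
  (forall y, (0 <= g y)%R) -> \int[P]_w (g (X w))%:E = (g 0%R)%:E.
Proof.
move=> s0 mg g0; rewrite -[LHS](@ge0_integral_distribution _ _ _ _ _ _ X (EFin \o g));
  last 2 first.
- exact/measurable_EFinP.
- by move=> y; rewrite lee_fin.
rewrite (@eq_measure_integral _ _ _ _ (\d_ (0%R : R))).
  by rewrite integral_dirac//= ?diracT ?mul1e//; exact/measurable_EFinP.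
by move=> A mA _; rewrite [LHS](lawX mA) /gaussian_law s0 eqxx.
Qed.

Let ge0_integral_normal (g : R -> R) : sigma != 0%R -> measurable_fun setT g ->
  (forall y, (0 <= g y)%R) ->
  \int[P]_w (g (X w))%:E = \int[mu]_x (g x * normal_pdf 0 sigma x)%:E.
Proof.
move=> s0 mg g0; rewrite -[LHS](@ge0_integral_distribution _ _ _ _ _ _ X (EFin \o g));
  last 2 first.
- exact/measurable_EFinP.
- by move=> y; rewrite lee_fin.
apply: (@ge0_integral_weighted _ _ _ _ R mu (distribution P X) id
  (normal_pdf 0 sigma)) => //.
- exact: measurable_normal_pdf.
- by move=> x; exact: normal_pdf_ge0.
- by move=> A mA; rewrite [LHS](lawX mA) /gaussian_law (negbTE s0).
Qed.

Let pdfE (t x : R) : t != 0%R ->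
  normal_pdf 0 t x = (normal_peak t * normal_fun 0 t x)%R.
Proof. by rewrite /normal_pdf => /negbTE ->. Qed.

Let ge0_integral_opp (g : R -> R) : measurable_fun setT g ->
  (forall y, (0 <= g y)%R) ->
  \int[P]_w (g (X w))%:E = \int[P]_w (g (- X w)%R)%:E.
Proof.
move=> mg g0.
have mgN : measurable_fun setT (fun y : R => g (- y)%R) by exact: measurableT_comp.
have [s0|s0] := eqVneq sigma 0%R.
  by rewrite (ge0_integral_dirac s0 mg g0) (ge0_integral_dirac s0 mgN)//= oppr0.
rewrite (ge0_integral_normal s0 mg g0) (ge0_integral_normal s0 mgN)//.
have mgp : measurable_fun setT (fun x : R => g x * normal_pdf 0 sigma x)%R.
  by apply: measurable_funM => //; exact: measurable_normal_pdf.
transitivity (\int[pushforward mu (-%R : R -> measurableTypeR R)]_x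
    (g x * normal_pdf 0 sigma x)%:E).
  by apply: eq_measure_integral => A mA _; exact/esym/lebesgue_measureN.
rewrite ge0_integral_pushforward//; last 2 first.
- exact/measurable_EFinP.
- by move=> y _; rewrite lee_fin mulr_ge0// normal_pdf_ge0.
rewrite preimage_setT; apply: eq_integral => x _ /=.
by rewrite !pdfE// /normal_fun !subr0 sqrrN.
Qed.

(** The second moment is bounded without integrating by parts, by comparing two
normal densities: the one with the larger deviation s' is, up to the factor
sigma / s', the other one times exp (h x^2) >= 1 + h x^2, and both have total
mass 1. This gives 1 + h E X^2 <= s' / sigma, where
h = 1 / (2 sigma^2) - 1 / (2 s'^2). *)
Let normal_second_moment_lt s' : (0 < sigma)%R -> (sigma < s')%R ->
  \int[P]_w (X w ^+ 2)%:E <= (s' ^+ 2)%:E.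
Proof.
move=> s0 ss'; have s'0 : (0 < s')%R by exact: lt_trans ss'.
pose h := ((sigma ^+ 2 *+ 2)^-1 - (s' ^+ 2 *+ 2)^-1)%R.
have h0 : (0 < h)%R.
  rewrite subr_gt0 ltf_pV2 ?posrE ?pmulrn_lgt0 ?exprn_gt0//.
  by rewrite ltr_pMn2r// ltr_sqr ?nnegrE ?ltW.
have pdf_le x : (normal_pdf 0 sigma x + h * (x ^+ 2 * normal_pdf 0 sigma x) <=
    s' / sigma * normal_pdf 0 s' x)%R.
  rewrite !pdfE ?gt_eqF//.
  have -> : normal_fun 0 s' x = (normal_fun 0 sigma x * expR (h * x ^+ 2))%R.
    rewrite /normal_fun -expRD; congr expR; rewrite subr0 /h.
    by field; rewrite !gt_eqF.
  have -> : normal_peak s' = (sigma / s' * normal_peak sigma)%R.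
    have peakE (t : R) : (0 < t)%R ->
        normal_peak t = (t^-1 * (Num.sqrt (pi *+ 2))^-1)%R.
      move=> t0; rewrite /normal_peak -mulrnAr sqrtrM ?sqr_ge0//.
      by rewrite sqrtr_sqr gtr0_norm// invfM.
    rewrite !peakE//; field.
    by rewrite !gt_eqF// sqrtr_gt0 pmulrn_lgt0// pi_gt0.
  have := expR_ge1Dx (h * x ^+ 2).
  have := normal_fun_ge0 0 sigma x; have := normal_peak_ge0 sigma.
  set a := normal_peak sigma; set b := normal_fun 0 sigma x; set e := expR _.
  move=> a0 b0 he.
  have -> : (s' / sigma * (sigma / s' * a * (b * e)) = a * b * e)%R.
    by field; rewrite !gt_eqF.
  have -> : (a * b + h * (x ^+ 2 * (a * b)) = a * b * (1 + h * x ^+ 2))%R by ring.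
  by rewrite ler_wpM2l// mulr_ge0.
have mp t :
  measurable_fun (setT : set (measurableTypeR R)) (normal_pdf (0 : R) t).
  by exact: measurable_normal_pdf.
have mxp : measurable_fun (setT : set (measurableTypeR R))
    (fun x : R => x ^+ 2 * normal_pdf (0 : R) sigma x)%R.
  by apply: measurable_funM => //; exact: measurable_funX.
have p0 t x : (0 <= normal_pdf (0 : R) t x)%R by exact: normal_pdf_ge0.
have : \int[mu]_x
      (normal_pdf 0 sigma x + h * (x ^+ 2 * normal_pdf 0 sigma x))%:E <=
    \int[mu]_x (s' / sigma * normal_pdf 0 s' x)%:E.
  apply: ge0_le_integral => //.
  - by move=> x _; rewrite lee_fin addr_ge0// mulr_ge0 ?(ltW h0)// mulr_ge0// sqr_ge0.
  - by apply/measurable_EFinP; apply: measurable_funD => //; apply: measurable_funM.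
  - by apply/measurable_EFinP; apply: measurable_funM.
  - by move=> x _; rewrite lee_fin.
under eq_integral do rewrite EFinD EFinM.
rewrite ge0_integralD//; last 4 first.
- by move=> x _; rewrite lee_fin.
- exact/measurable_EFinP.
- by move=> x _; rewrite -EFinM lee_fin mulr_ge0 ?(ltW h0)// mulr_ge0// sqr_ge0.
- by under eq_fun do rewrite -EFinM; apply/measurable_EFinP; apply: measurable_funM.
rewrite ge0_integralZl//; last 3 first.
- exact/measurable_EFinP.
- by move=> x _; rewrite lee_fin mulr_ge0// sqr_ge0.
- by rewrite lee_fin ltW.
under [X in _ <= X]eq_integral do rewrite EFinM.
rewrite ge0_integralZl//; last 3 first.
- exact/measurable_EFinP.
- by move=> x _; rewrite lee_fin.
- by rewrite lee_fin divr_ge0// ltW.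
rewrite !integral_normal_pdf mule1.
rewrite (ge0_integral_normal (g := fun x : R => x ^+ 2)%R); last 3 first.
- by rewrite gt_eqF.
- exact: measurable_funX.
- by move=> y; exact: sqr_ge0.
have : 0 <= \int[mu]_x (x ^+ 2 * normal_pdf 0 sigma x)%:E.
  by apply: integral_ge0 => x _; rewrite lee_fin mulr_ge0// sqr_ge0.
case: (\int[mu]_x _) => [m|_|//]; last first.
  by rewrite gt0_muley ?lte_fin// addey.
rewrite -EFinM -EFinD !lee_fin => m0 hm.
have sum0 : (0 < s' + sigma)%R by rewrite addr_gt0.
have hE : (h = (s' - sigma) * (s' + sigma) / (2 * sigma ^+ 2 * s' ^+ 2))%R.
  by rewrite /h; field; rewrite !gt_eqF.
have : ((s' + sigma) * m <= 2 * sigma * s' ^+ 2)%R.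
  have d0 : (0 < (s' - sigma) / (2 * sigma ^+ 2 * s' ^+ 2))%R.
    by rewrite divr_gt0 ?subr_gt0// !mulr_gt0.
  rewrite -(ler_pM2l d0).
  have -> : ((s' - sigma) / (2 * sigma ^+ 2 * s' ^+ 2) * ((s' + sigma) * m) =
      h * m)%R.
    by rewrite hE; ring.
  have -> : ((s' - sigma) / (2 * sigma ^+ 2 * s' ^+ 2) * (2 * sigma * s' ^+ 2)
      = s' / sigma - 1)%R by field; rewrite !gt_eqF.
  by rewrite lerBrDl.
have : (2 * sigma * s' ^+ 2 <= (s' + sigma) * s' ^+ 2)%R.
  by rewrite ler_wpM2r ?sqr_ge0//; lra.
move=> h1 h2; rewrite -(ler_pM2l sum0); exact: le_trans h1.
Qed.

Lemma gaussian_second_moment_le : \int[P]_w (X w ^+ 2)%:E <= (sigma ^+ 2)%:E.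
Proof.
move: sigma0; rewrite le_eqVlt => /predU1P[s0|s0].
  rewrite (ge0_integral_dirac (g := fun x : R => x ^+ 2)%R (esym s0)).
  - by rewrite -s0.
  - exact: measurable_funX.
  - by move=> y; exact: sqr_ge0.
have : forall s', (sigma < s')%R -> \int[P]_w (X w ^+ 2)%:E <= (s' ^+ 2)%:E.
  by move=> s'; exact: normal_second_moment_lt.
have : 0 <= \int[P]_w (X w ^+ 2)%:E.
  by apply: integral_ge0 => w _; rewrite lee_fin sqr_ge0.
case: (\int[P]_w _) => [m||//]; last first.
  by move=> _ /(_ (sigma + 1)%R); rewrite ltrDl ltr01 => /(_ isT).
(* If sigma^2 < E X^2, the deviation halfway between sigma and sqrt (E X^2)
   violates the bound. *)
rewrite lee_fin => m0 hm; rewrite lee_fin leNgt; apply/negP => sm.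
have sm' : (sigma < Num.sqrt m)%R.
  by rewrite -(ger0_norm sigma0) -sqrtr_sqr ltr_sqrt// (le_lt_trans _ sm)// sqr_ge0.
have := hm ((sigma + Num.sqrt m) / 2)%R; rewrite midf_lt// => /(_ isT).
rewrite lee_fin leNgt => /negP; apply.
rewrite -[ltRHS]sqr_sqrtr// ltr_sqr ?nnegrE ?midf_lt//.
by rewrite divr_ge0// addr_ge0// sqrtr_ge0.
Qed.

Lemma gaussian_has_second_moment :
  {v | has_mean P (fun w => X w ^+ 2)%R v & (0 <= v <= sigma ^+ 2)%R}.
Proof.
have fin : \int[P]_w (X w ^+ 2)%:E \is a fin_num.
  rewrite ge0_fin_numE; last by apply: integral_ge0 => w _; rewrite lee_fin sqr_ge0.
  by rewrite (le_lt_trans gaussian_second_moment_le)// ltry.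
exists (fine (\int[P]_w (X w ^+ 2)%:E)).
  apply: ge0_has_mean; last by rewrite fineK.
    by apply: measurable_funX; exact: (measurable_funP X).
  by move=> w; exact: sqr_ge0.
rewrite -!lee_fin fineK// gaussian_second_moment_le andbT.
by apply: integral_ge0 => w _; rewrite lee_fin sqr_ge0.
Qed.

(** The law is symmetric, so the positive and negative parts of [X] have the same
expectation; integrability follows from |X| <= 1 + X^2. *)
Lemma gaussian_has_mean0 : has_mean P X 0.
Proof.
have mX : measurable_fun setT X by exact: (measurable_funP X).
have iX : P.-integrable setT (EFin \o X).
  have [v [hv _] _] := gaussian_has_second_moment.
  apply: (@le_integrable _ _ _ _ _ _ _ (EFin \o (fun w => 1 + X w ^+ 2)%R)) => //.
  - exact/measurable_EFinP.
  - move=> w _; rewrite /= lee_fin [leRHS]ger0_norm ?addr_ge0 ?sqr_ge0//.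
    rewrite -(real_normK (num_real (X w))).
    by have := sqr_ge0 (`|X w| - 1)%R; have := normr_ge0 (X w); nra.
  - apply: (integrableD _ (f := cst 1)
      (g := EFin \o (fun w => X w ^+ 2)%R)) => //.
    exact: finite_measure_integrable_cst.
split=> //.
have E := @ge0_integral_opp (fun x : R => Num.max x 0)%R.
under eq_integral.
  move=> w _.
  have -> : X w = (Num.max (X w) 0 - Num.max (- X w) 0)%R.
    by rewrite -[LHS](congr1 (fun f => f w) (funrposBneg X)).
  rewrite EFinB; over.
rewrite integralB_EFin//; last 2 first.
- exact: (integrable_funrpos _ iX).
- exact: (integrable_funrneg _ iX).
rewrite E; last 2 first.
- by apply: measurable_maxr.
- by move=> y; rewrite le_max lexx orbT.
rewrite subee//; exact: (integrable_fin_num _ (integrable_funrneg _ iX)).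
Qed.

End gaussian_moments.

(** * Second moments of orthogonal sums *)

Section orthogonal_family.
Local Open Scope ereal_scope.
Context d (T : measurableType d) (R : realType) (P : probability T R).

(** In the expansion of the squared sum only the diagonal terms have nonzero
expectation. *)
Lemma integral_norm_orthogonal_sum_le (K : finType) (V : K -> T -> R)
    (a c : K -> R) (B : R) :
  (forall k, measurable_fun setT (V k)) ->
  (forall k l, k != l -> has_mean P (fun w => V k w * V l w)%R 0) ->
  (forall k, has_mean P (fun w => V k w ^+ 2)%R (c k)) ->
  (forall k, (c k <= B)%R) -> (0 <= B)%R ->
  \int[P]_w (`|\sum_k a k * V k w|%R)%:E <=
    (Num.sqrt (B * \sum_k a k ^+ 2))%:E.
Proof.
move=> mV V0 Vc cB B0.
have S0 : (0 <= B * \sum_k a k ^+ 2)%R.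
  by rewrite mulr_ge0// sumr_ge0// => k _; exact: sqr_ge0.
pose C k l : R := if k == l then c k else 0%R.
have hC k l : has_mean P (fun w => V k w * V l w)%R (C k l).
  by rewrite /C; case: eqVneq => [<-|]; [exact: Vc|exact: V0].
apply: (@integral_norm_le _ _ _ _ _ (\sum_k \sum_l a k * a l * C k l)%R).
- by apply: measurable_sum => k; apply: measurable_funM.
- under eq_fun => w.
    rewrite expr2 big_distrlr/=.
    under eq_bigr do under eq_bigr do rewrite mulrACA.
    over.
  by do 2![apply: has_mean_sum => ?]; exact: has_meanZ.
- exact: sqrtr_ge0.
- rewrite sqr_sqrtr// mulr_sumr; apply: ler_sum => k _.
  rewrite (bigD1 k)//= [X in (_ + X)%R]big1 ?addr0; last first.
    by move=> l lk; rewrite /C eq_sym (negbTE lk) mulr0.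
  by rewrite /C eqxx -expr2 mulrC ler_wpM2r// sqr_ge0.
Qed.

End orthogonal_family.

Section independent_monomials.
Context d (T : measurableType d) (R : realType) (P : probability T R).
Context (I : finType) (n : I -> {RV P >-> R}) (v : I -> R).
Hypothesis indn : mutually_independent n.
Hypothesis n1 : forall i, has_mean P (n i) 0.
Hypothesis n2 : forall i, has_mean P (fun w => n i w ^+ 2) (v i).

Let moment i k : R := if k is k'.+1 then if k' is _.+1 then v i else 0 else 1.

(** Exponents are at most 2, so the first two moments of each variable determine
the expectation of a monomial; it vanishes when some exponent is 1. *)
Let has_mean_monomial (e : I -> nat) : (forall i, (e i <= 2)%N) ->
  has_mean P (fun w => \prod_i n i w ^+ e i) (\prod_i moment i (e i)).
Proof.
move=> e2; apply: (has_mean_prod_independent indn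
  (g := fun i (x : R) => x ^+ e i)).
  by move=> i; exact: measurable_funX.
move=> i; rewrite /moment; case: (e i) (e2 i) => [|[|[|//]]] _ /=.
- exact: has_mean_cst.
- exact: n1.
- exact: n2.
Qed.

Let prod_delta (x : I -> R) i : \prod_a x a ^+ (a == i) = x i.
Proof.
rewrite (bigD1 i)//= eqxx expr1 big1 ?mulr1// => a /negbTE ->.
by rewrite expr0.
Qed.

Lemma has_mean_mul_independent i j : i != j ->
  has_mean P (fun w => n i w * n j w) 0.
Proof.
move=> ij; pose e a := ((a == i) + (a == j))%N.
have -> : 0 = \prod_a moment a (e a) :> R.
  by rewrite (bigD1 i)//= /e eqxx (negbTE ij) mul0r.
under eq_fun => w.
  rewrite -(prod_delta (n ^~ w) i) -(prod_delta (n ^~ w) j) -big_split/=.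
  under eq_bigr do rewrite -exprD.
  over.
by apply: has_mean_monomial => a; rewrite /e; do 2!case: eqP.
Qed.

Let has_mean_monomial4 i j k l
    (e := fun a => ((a == i) + (a == j) + ((a == k) + (a == l)))%N) :
  i != j -> k != l ->
  has_mean P (fun w => n i w * n j w * (n k w * n l w))
    (\prod_a moment a (e a)).
Proof.
move=> ij kl; under eq_fun => w.
  rewrite -(prod_delta (n ^~ w) i) -(prod_delta (n ^~ w) j).
  rewrite -(prod_delta (n ^~ w) k) -(prod_delta (n ^~ w) l) -!big_split/=.
  under eq_bigr do rewrite -!exprD.
  over.
apply: has_mean_monomial => a; rewrite /e.
move: ij kl; case: (eqVneq a i) => [->|_]; [move=> /negbTE ->|move=> _];
  case: (eqVneq _ k) => [->|_];
  [move=> /negbTE ->|move=> _|move=> /negbTE ->|move=> _];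
  by do ?case: eqP.
Qed.

(** Two different unordered pairs share at most one element, so an element of the
first pair outside the second has exponent 1 in the product. *)
Lemma has_mean_mul_pairs i j k l : i != j -> k != l ->
  ~~ [|| (i == k) && (j == l) | (i == l) && (j == k)] ->
  has_mean P (fun w => n i w * n j w * (n k w * n l w)) 0.
Proof.
move=> ij kl ne; pose e a := ((a == i) + (a == j) + ((a == k) + (a == l)))%N.
have : has_mean P _ (\prod_a moment a (e a)) := has_mean_monomial4 ij kl.
suff [a ea] : exists a, e a = 1%N.
  by rewrite (bigD1 a)//= {1}/moment ea mul0r.
have ji : (j == i) = false by rewrite eq_sym (negbTE ij).
have lk : (l == k) = false by rewrite eq_sym (negbTE kl).
move: ne; rewrite negb_or !negb_and.
case: (eqVneq i k) => [ik|ik] /=.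
  move=> /andP[jl _]; exists j; rewrite /e eqxx ji -ik ji.
  by rewrite (negbTE jl).
case: (eqVneq i l) => [il|il] /=.
  move=> jk; exists j; rewrite /e eqxx ji -il ji.
  by rewrite (negbTE jk).
by move=> _; exists i; rewrite /e eqxx (negbTE ij) (negbTE ik) (negbTE il).
Qed.

Lemma has_mean_sqr_pair i j : i != j ->
  has_mean P (fun w => (n i w * n j w) ^+ 2) (v i * v j).
Proof.
move=> ij; have := has_mean_monomial4 ij ij.
have ji : j != i by rewrite eq_sym.
rewrite (bigD1 i)// (bigD1 j)//= big1; last first.
  by move=> a /andP[/negbTE -> /negbTE ->].
by rewrite !eqxx (negbTE ij) (negbTE ji) /= mulr1.
Qed.

End independent_monomials.

(** * Trigonometric sums and the Fourier vector *)

Section trigonometric_sums.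
Context (R : realType).
Implicit Types (a : R).

Lemma expiD a b : expi (a + b) = expi a * expi b :> R[i].
Proof.
rewrite /expi cosD sinD; apply/eqP.
by rewrite eq_complex/= eqxx addrC eqxx.
Qed.

Lemma expi0 : expi 0 = 1 :> R[i].
Proof. by rewrite /expi cos0 sin0. Qed.

Lemma expiMn a k : expi (a * k%:R) = expi a ^+ k.
Proof.
elim: k => [|k IH]; first by rewrite mulr0 expi0.
by rewrite -natr1 mulrDr mulr1 expiD IH exprSr.
Qed.

Lemma expi_2pi k : expi (- (2 * pi * k%:R)) = 1 :> R[i].
Proof.
rewrite -mulNr expiMn; have -> : expi (- (2 * pi)) = 1 :> R[i].
  by rewrite /expi cosN sinN mulr_natl cos2pi sin2pi oppr0.
exact: expr1n.
Qed.

Lemma sum_expi (I : finType) (F : I -> R) :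
  \sum_t expi (F t) = (\sum_t cos (F t)) +i* (\sum_t sin (F t)) :> R[i].
Proof.
elim/big_rec3: _ => [//|t x y z _ ->].
by apply/eqP; rewrite eq_complex/= !eqxx.
Qed.

(** The angle lies strictly between 0 and 2 pi and differs from pi; above pi it is
reflected to the angle of the frequency L - f. *)
Lemma sin_frequency_neq0 (L f : nat) : (0 < f < L)%N -> (2 * f)%N <> L ->
  sin (2 * pi * f%:R / L%:R) != 0 :> R.
Proof.
move=> /andP[f0 fL] fL2.
have L0 : 0 < L%:R :> R by rewrite ltr0n (leq_trans f0)// ltnW.
have F0 : 0 < f%:R :> R by rewrite ltr0n.
have pi0 := pi_gt0 R.
have [h|h|//] := ltngtP (2 * f)%N L.
  rewrite gt_eqF// sin_gt0_pi// divr_gt0 ?mulr_gt0//= ltr_pdivrMr//.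
  by rewrite mulrAC mulrC ltr_pM2l// -natrM ltr_nat.
have -> : 2 * pi * f%:R / L%:R = pi *+ 2 - 2 * pi * (L - f)%:R / L%:R :> R.
  rewrite natrB 1?ltnW//; field; by rewrite gt_eqF.
rewrite sinB sin2pi cos2pi mul0r mul1r sub0r oppr_eq0 gt_eqF// sin_gt0_pi//.
rewrite divr_gt0 ?mulr_gt0//= ?ltr0n ?subn_gt0// ltr_pdivrMr//.
rewrite mulrAC mulrC ltr_pM2l// -natrM ltr_nat; lia.
Qed.

(** A full geometric sum of the powers of [expi (2 * a)], an [L]-th root of unity
different from 1 because its real part is 1 - 2 sin^2 a. *)
Lemma sum_double_angle (L : nat) a : expi a ^+ L = 1 -> sin a != 0 ->
  \sum_(t < L) cos (2 * a * t%:R) = 0 /\ \sum_(t < L) sin (2 * a * t%:R) = 0.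
Proof.
move=> aL sa.
suff : \sum_(t < L) expi (2 * a * t%:R) = 0 by rewrite sum_expi => -[].
under eq_bigr do rewrite expiMn.
have z1 : expi (2 * a) - 1 != 0.
  rewrite subr_eq0; apply: contra sa => /eqP[+ _].
  rewrite mulr_natl cos_mulr2n => h; rewrite -sqrf_eq0 sin2cos2.
  apply/eqP; move: h; lra.
apply: (mulfI z1); rewrite mulr0 -subrX1.
by rewrite mulrC expiMn -exprM mulnC exprM aL expr1n subrr.
Qed.

(** The squared Frobenius norm of A A^T + B B^T for orthogonal vectors of squared
norm 1/2. *)
Lemma sum_sqr_cross (I : finType) (A B : I -> R) :
  \sum_t A t ^+ 2 = 2^-1 -> \sum_t B t ^+ 2 = 2^-1 -> \sum_t A t * B t = 0 ->
  \sum_s \sum_t (A s * A t + B s * B t) ^+ 2 = 2^-1.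
Proof.
move=> hA hB hAB.
transitivity ((\sum_s A s ^+ 2) * (\sum_t A t ^+ 2) +
   (\sum_s B s ^+ 2) * (\sum_t B t ^+ 2) +
   2 * ((\sum_s A s * B s) * (\sum_t A t * B t))); last first.
  by rewrite hA hB hAB; field.
rewrite !big_distrlr/= mulr_sumr -!big_split/=; apply: eq_bigr => s _.
rewrite mulr_sumr -!big_split/=; apply: eq_bigr => t _; ring.
Qed.

End trigonometric_sums.

Section dft_coordinates.
Context (R : realType) (L : nat) (f : 'I_L).

(** Together with [dft_im], the coordinates of the Fourier vector at frequency [f]:
real arithmetic on these two real vectors replaces that of complex numbers. *)
Definition dft_re (t : 'I_L) : R :=
  (Num.sqrt L%:R)^-1 * cos (- (2 * pi * f%:R / L%:R) * t%:R).

Definition dft_im (t : 'I_L) : R :=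
  (Num.sqrt L%:R)^-1 * sin (- (2 * pi * f%:R / L%:R) * t%:R).

Lemma dftE (u : 'I_L -> R[i]) : dft u f = \sum_t u t * (dft_re t +i* dft_im t).
Proof.
rewrite /dft mulr_sumr; apply: eq_bigr => t _; rewrite mulrCA; congr (_ * _).
have -> : - (2 * pi * f%:R * t%:R / L%:R) =
    - (2 * pi * f%:R / L%:R) * t%:R :> R by ring.
by apply/eqP; rewrite eq_complex/= !mul0r subr0 addr0 !eqxx.
Qed.

Lemma dft_real (u : 'I_L -> R) : dft (fun t => (u t)%:C) f =
  (\sum_t u t * dft_re t) +i* (\sum_t u t * dft_im t).
Proof.
rewrite dftE; elim/big_rec3: _ => [//|t x y z _ ->].
by apply/eqP; rewrite eq_complex/= !mul0r subr0 addr0 !eqxx.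
Qed.

Hypotheses (f0 : f <> 0%N :> nat) (fL2 : (2 * f)%N <> L).

Let L0 : 0 < L%:R :> R.
Proof. by rewrite ltr0n (leq_trans _ (ltn_ord f)). Qed.

Let rootL2 : (Num.sqrt L%:R)^-1 ^+ 2 = L%:R^-1 :> R.
Proof. by rewrite exprVn sqr_sqrtr// ltW. Qed.

Let double_angle (a b : R) : 2 * a * b = (a * b) *+ 2.
Proof. by ring. Qed.

Let double_angle_sums :
  \sum_(t < L) cos (2 * - (2 * pi * f%:R / L%:R) * t%:R) = 0 :> R /\
  \sum_(t < L) sin (2 * - (2 * pi * f%:R / L%:R) * t%:R) = 0 :> R.
Proof.
apply: sum_double_angle; last first.
  rewrite sinN oppr_eq0 sin_frequency_neq0// ltn_ord andbT lt0n.
  exact/eqP.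
by rewrite -expiMn mulNr divfK ?gt_eqF// expi_2pi.
Qed.

Lemma sum_dft_re_sqr : \sum_t dft_re t ^+ 2 = 2^-1.
Proof.
transitivity (\sum_(t < L) (L%:R^-1 / 2 +
    L%:R^-1 / 2 * cos (2 * - (2 * pi * f%:R / L%:R) * t%:R)) : R).
  apply: eq_bigr => t _; rewrite /dft_re exprMn rootL2 (double_angle (- _)) cos_mulr2n.
  by field; rewrite gt_eqF.
rewrite big_split/= -[X in _ + X]mulr_sumr double_angle_sums.1 mulr0 addr0.
by rewrite sumr_const card_ord -mulr_natl; field; rewrite gt_eqF.
Qed.

Lemma sum_dft_im_sqr : \sum_t dft_im t ^+ 2 = 2^-1.
Proof.
transitivity (\sum_(t < L) (L%:R^-1 / 2 -
    L%:R^-1 / 2 * cos (2 * - (2 * pi * f%:R / L%:R) * t%:R)) : R).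
  apply: eq_bigr => t _; rewrite /dft_im exprMn rootL2 (double_angle (- _)) cos_mulr2n.
  by rewrite sin2cos2; field; rewrite gt_eqF.
rewrite sumrB/= -[X in _ - X]mulr_sumr double_angle_sums.1 mulr0 subr0.
by rewrite sumr_const card_ord -mulr_natl; field; rewrite gt_eqF.
Qed.

Lemma sum_dft_re_im : \sum_t dft_re t * dft_im t = 0.
Proof.
transitivity (\sum_(t < L)
    L%:R^-1 / 2 * sin (2 * - (2 * pi * f%:R / L%:R) * t%:R) : R).
  apply: eq_bigr => t _; rewrite /dft_re /dft_im mulrACA -expr2 rootL2.
  rewrite (double_angle (- _)) sin_mulr2n.
  by field; rewrite gt_eqF.
by rewrite -mulr_sumr double_angle_sums.2 mulr0.
Qed.

End dft_coordinates.

(** * Windows and the periodogram *)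

Section windows.

Lemma window_index_inj (L M : nat) (m m' : 'I_M) (t t' : 'I_L) :
  window_index m t = window_index m' t' -> m = m' /\ t = t'.
Proof.
move=> /(congr1 val)/= e; have L0 : (0 < L)%N by exact: leq_ltn_trans (ltn_ord t).
have em : m = m' :> nat.
  have := congr1 (divn ^~ L) e.
  by rewrite !divnMDl// !divn_small ?addn0.
split; apply: val_inj => //=.
by move: e; rewrite em => /addnI.
Qed.

Lemma ordS_neq (M : nat) (m : 'I_M) : (1 < M)%N -> ordS m != m.
Proof.
move=> hM; rewrite -val_eqE/=; have := ltn_ord m.
rewrite leq_eqVlt => /predU1P[mM|mM]; first by rewrite mM modnn; lia.
by rewrite modn_small//; lia.
Qed.

(** The only place that needs three windows: with two of them, the pairs (m, m + 1)
and (m + 1, m) join the same windows. *)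
Lemma ordS2_neq (M : nat) (m : 'I_M) : (2 < M)%N -> ordS (ordS m) != m.
Proof.
move=> hM; rewrite -val_eqE/=; have := ltn_ord m.
rewrite leq_eqVlt => /predU1P[mM|mM].
  by rewrite mM modnn modn_small; lia.
rewrite (modn_small mM); move: mM; rewrite leq_eqVlt => /predU1P[mM|mM].
  by rewrite mM modnn; lia.
by rewrite modn_small//; lia.
Qed.

End windows.

Section decomposition.
Context (R : realType) (L M : nat) (f : 'I_L).
Hypothesis M0 : (0 < M)%N.

(** The two linear terms Re (X N_(m+1)^* ) and Re (N_m X^* ) have the same sum over
the cyclically ordered windows, whence the factor 2. *)
Lemma cross_periodogram_decomposition (x : 'I_L -> R[i])
    (y : 'I_(L * M) -> R[i]) (n : 'I_(L * M) -> R)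
    (p := complex.Re (dft x f)) (q := complex.Im (dft x f)) :
  (forall m t, y (window_index m t) = x t + (n (window_index m t))%:C) ->
  cross_periodogram y f = cmod (dft x f) ^+ 2 +
    \sum_(k : 'I_M * 'I_L)
       2 / M%:R * (p * dft_re R f k.2 + q * dft_im R f k.2) *
       n (window_index k.1 k.2) +
    \sum_(k : 'I_M * ('I_L * 'I_L))
       M%:R^-1 * (dft_re R f k.2.1 * dft_re R f k.2.2 +
                  dft_im R f k.2.1 * dft_im R f k.2.2) *
       (n (window_index k.1 k.2.1) * n (window_index (ordS k.1) k.2.2)).
Proof.
move=> yE.
have M0' : M%:R != 0 :> R by rewrite pnatr_eq0 -lt0n.
pose a m := \sum_t n (window_index m t) * dft_re R f t.
pose b m := \sum_t n (window_index m t) * dft_im R f t.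
have YE m : dft (window y m) f = (p + a m) +i* (q + b m).
  transitivity (dft x f + dft (fun t => (n (window_index m t))%:C) f).
    rewrite !dftE -big_split/=; apply: eq_bigr => t _.
    by rewrite /window yE mulrDl.
  by rewrite dft_real /p /q; case: (dft x f).
have cmodE : cmod (dft x f) ^+ 2 = p ^+ 2 + q ^+ 2.
  rewrite /cmod /p /q; case: (dft x f) => p' q' /=.
  by rewrite sqr_sqrtr// addr_ge0// sqr_ge0.
have shift (c : 'I_M -> R) : \sum_m c (ordS m) = \sum_m c m.
  by rewrite [RHS](reindex_onto (@ordS M) (@ord_pred M))/=;
    [apply: eq_bigl => m; rewrite ordSK eqxx|move=> m _; rewrite ord_predK].
have linE : \sum_(k : 'I_M * 'I_L) 2 / M%:R *
    (p * dft_re R f k.2 + q * dft_im R f k.2) * n (window_index k.1 k.2) =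
    2 / M%:R * \sum_m (p * a m + q * b m).
  rewrite -(pair_bigA _ (fun m t => 2 / M%:R *
    (p * dft_re R f t + q * dft_im R f t) * n (window_index m t)))/= mulr_sumr.
  apply: eq_bigr => m _; rewrite /a /b !mulr_sumr -big_split/= mulr_sumr.
  by apply: eq_bigr => t _; ring.
have quadE : \sum_(k : 'I_M * ('I_L * 'I_L)) M%:R^-1 *
     (dft_re R f k.2.1 * dft_re R f k.2.2 +
      dft_im R f k.2.1 * dft_im R f k.2.2) *
       (n (window_index k.1 k.2.1) * n (window_index (ordS k.1) k.2.2)) =
    M%:R^-1 * \sum_m (a m * a (ordS m) + b m * b (ordS m)).
  rewrite -(pair_bigA _ (fun m (k : 'I_L * 'I_L) => M%:R^-1 *
     (dft_re R f k.1 * dft_re R f k.2 + dft_im R f k.1 * dft_im R f k.2) *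
       (n (window_index m k.1) * n (window_index (ordS m) k.2))))/= mulr_sumr.
  apply: eq_bigr => m _; rewrite /a /b !big_distrlr/= -big_split/= mulr_sumr.
  rewrite -(pair_bigA _ (fun s t => M%:R^-1 *
     (dft_re R f s * dft_re R f t + dft_im R f s * dft_im R f t) *
       (n (window_index m s) * n (window_index (ordS m) t))))/=.
  apply: eq_bigr => s _; rewrite -big_split/= mulr_sumr.
  by apply: eq_bigr => t _; ring.
rewrite linE quadE cmodE /cross_periodogram.
transitivity (M%:R^-1 * \sum_m ((p ^+ 2 + q ^+ 2) + (p * a m + q * b m) +
   (p * a (ordS m) + q * b (ordS m)) + (a m * a (ordS m) + b m * b (ordS m)))).
  by congr (_ * _); apply: eq_bigr => m _; rewrite !YE/=; ring.
move: (p ^+ 2 + q ^+ 2) => c.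
rewrite !big_split/= (shift (fun m => p * a m)) (shift (fun m => q * b m)).
rewrite sumr_const card_ord -mulr_natl.
by field.
Qed.

End decomposition.

(** * The noise terms and the bound *)

Section noise_bounds.
Local Open Scope ereal_scope.
Context d (T : measurableType d) (R : realType) (P : probability T R).
Context (L M : nat) (n : 'I_(L * M) -> {RV P >-> R}) (sigma : R).
Context (v : 'I_(L * M) -> R).
Hypothesis sigma0 : (0 <= sigma)%R.
Hypothesis indn : mutually_independent n.
Hypothesis n1 : forall i, has_mean P (n i) 0.
Hypothesis n2 : forall i, has_mean P (fun w => n i w ^+ 2)%R (v i).
Hypothesis v_sigma : forall i, (0 <= v i <= sigma ^+ 2)%R.

Lemma integral_linear_noise_le (a : 'I_M * 'I_L -> R) :
  \int[P]_w (`|\sum_k a k * n (window_index k.1 k.2) w|%R)%:E <=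
    (Num.sqrt (sigma ^+ 2 * \sum_k a k ^+ 2))%:E.
Proof.
apply: (@integral_norm_orthogonal_sum_le _ _ _ _ _
  (fun k w => n (window_index k.1 k.2) w) _ (fun k => v (window_index k.1 k.2))) => //.
- move=> [m s] [m' s'] /= ne; apply: (has_mean_mul_independent indn n1 n2).
  by apply: contra ne => /eqP/window_index_inj[-> ->].
- by move=> k; case/andP: (v_sigma (window_index k.1 k.2)).
- exact: sqr_ge0.
Qed.

Lemma integral_quadratic_noise_le (a : 'I_M * ('I_L * 'I_L) -> R) : (2 < M)%N ->
  \int[P]_w (`|\sum_k a k *
      (n (window_index k.1 k.2.1) w * n (window_index (ordS k.1) k.2.2) w)|%R)%:E <=
    (Num.sqrt (sigma ^+ 4 * \sum_k a k ^+ 2))%:E.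
Proof.
move=> M2.
have diff m s t : window_index m s != window_index (@ordS M m) t :> 'I_(L * M).
  apply/eqP => /window_index_inj[e _].
  by have := ordS_neq m (ltnW M2); rewrite -e eqxx.
apply: (@integral_norm_orthogonal_sum_le _ _ _ _ _
  (fun k w => n (window_index k.1 k.2.1) w * n (window_index (ordS k.1) k.2.2) w)%R _
  (fun k => v (window_index k.1 k.2.1) * v (window_index (ordS k.1) k.2.2))%R).
- by move=> k; apply: measurable_funM.
- move=> [m [s t]] [m' [s' t']] /= ne; apply: (has_mean_mul_pairs indn n1 n2) => //.
  apply/negP => /orP[] /andP[/eqP/window_index_inj[e1 e2] /eqP/window_index_inj[e3 e4]].
    by move: ne; rewrite e1 e2 e4 eqxx.
  by have := ordS2_neq m' M2; rewrite -e1 e3 eqxx.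
- by move=> k; exact: has_mean_sqr_pair.
- move=> k; rewrite (exprD sigma 2 2).
  have /andP[h1 h2] := v_sigma (window_index k.1 k.2.1).
  have /andP[h3 h4] := v_sigma (window_index (ordS k.1) k.2.2).
  exact: ler_pM.
- by rewrite exprn_ge0.
Qed.

End noise_bounds.

Theorem theorem3 (d : measure_display) (T : measurableType d) (R : realType)
    (P : probability T R) (L M : nat) (hL : (1 <= L)%N) (hM : (3 <= M)%N)
    (x : int -> R[i]) (hx : periodic x L%:Z)
    (sigma : R) (hsigma : 0 <= sigma)
    (n : 'I_(L * M) -> {RV P >-> R}) (hn : iid_gaussian n 0 sigma)
    (y : 'I_(L * M) -> T -> R[i])
    (hy : forall (t : 'I_(L * M)) (w : T), y t w = x t%:Z + (n t w)%:C)
    (f : 'I_L) (hf0 : f <> 0%N :> nat) (hfL2 : (2 * f)%N <> L) :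
  let X := dft (fun t : 'I_L => x t%:Z) f in
  ('E_P[fun w : T => `|cross_periodogram (fun t => y t w) f|%R]
     - ((cmod X) ^+ 2)%:E
   <= (sigma * Num.sqrt pi * cmod X + sigma ^+ 2 / Num.sqrt (2 * M%:R))%:E)%E.
Proof.
cbv zeta; set X := dft (fun t : 'I_L => x t%:Z) f.
case: hn => indn lawn.
have n1 i := gaussian_has_mean0 hsigma (lawn i).
pose v i := s2val (gaussian_has_second_moment hsigma (lawn i)).
have n2 i : has_mean P (fun w => n i w ^+ 2) (v i) :=
  s2valP (gaussian_has_second_moment hsigma (lawn i)).
have v_sigma i : 0 <= v i <= sigma ^+ 2 :=
  s2valP' (gaussian_has_second_moment hsigma (lawn i)).
have M_gt0 : 0 < M%:R :> R by rewrite ltr0n (leq_trans _ hM).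
have XE : cmod X ^+ 2 = complex.Re X ^+ 2 + complex.Im X ^+ 2.
  by rewrite /cmod; case: X => p' q' /=; rewrite sqr_sqrtr// addr_ge0// sqr_ge0.
have cX0 : 0 <= cmod X.
  by rewrite /cmod; case: X {XE} => p' q' /=; exact: sqrtr_ge0.
set p := complex.Re X in XE; set q := complex.Im X in XE.
pose a (k : 'I_M * 'I_L) : R := 2 / M%:R * (p * dft_re R f k.2 + q * dft_im R f k.2).
pose b (k : 'I_M * ('I_L * 'I_L)) : R := M%:R^-1 *
  (dft_re R f k.2.1 * dft_re R f k.2.2 + dft_im R f k.2.1 * dft_im R f k.2.2).
pose lin w := \sum_k a k * n (window_index k.1 k.2) w.
pose quad w := \sum_k b k *
  (n (window_index k.1 k.2.1) w * n (window_index (ordS k.1) k.2.2) w).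
have PE w : cross_periodogram (fun t => y t w) f = cmod X ^+ 2 + lin w + quad w.
  apply: (@cross_periodogram_decomposition _ _ _ _ (ltnW (ltnW hM))
    (fun t : 'I_L => x t%:Z) _ (fun i => n i w)) => m t.
  rewrite hy; congr (_ + _) => /=; rewrite -(periodicn hx m t%:Z).
  by congr x; rewrite PoszD PoszM -mulr_natr addrC mulrC natz.
have mlin : measurable_fun setT lin.
  by apply: measurable_sum => k; apply: measurable_funM.
have mquad : measurable_fun setT quad.
  by apply: measurable_sum => k; apply: measurable_funM => //; apply: measurable_funM.
have lin_le :
    (\int[P]_w (`|lin w|%R)%:E <= (sigma * Num.sqrt pi * cmod X)%:E)%E.
  apply: (le_trans (integral_linear_noise_le indn n1 n2 v_sigma a)).
  rewrite lee_fin.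
  have -> : \sum_k a k ^+ 2 = 2 / M%:R * cmod X ^+ 2.
    rewrite -(pair_bigA _ (fun m t =>
      (2 / M%:R * (p * dft_re R f t + q * dft_im R f t)) ^+ 2))/=.
    rewrite sumr_const card_ord -[LHS]mulr_natl.
    have -> : \sum_(t < L)
        (2 / M%:R * (p * dft_re R f t + q * dft_im R f t)) ^+ 2 =
        (2 / M%:R) ^+ 2 * (p ^+ 2 * \sum_t dft_re R f t ^+ 2 +
          q ^+ 2 * \sum_t dft_im R f t ^+ 2 +
          2 * p * q * \sum_t dft_re R f t * dft_im R f t).
      rewrite !mulr_sumr -!big_split/= mulr_sumr; apply: eq_bigr => t _; ring.
    rewrite sum_dft_re_sqr// sum_dft_im_sqr// sum_dft_re_im// XE.
    by field; rewrite gt_eqF.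
  rewrite sqrtrM ?sqr_ge0// sqrtr_sqr ger0_norm// -[leRHS]mulrA ler_wpM2l//.
  rewrite sqrtrM ?divr_ge0 ?(ltW M_gt0)// sqrtr_sqr ger0_norm// ler_wpM2r//.
  rewrite ler_sqrt ?pi_ge0// ler_pdivrMr//.
  apply: (le_trans (pi_ge2 R)); rewrite ler_peMr ?pi_ge0// ler1n; exact: leq_trans hM.
have quad_le :
    (\int[P]_w (`|quad w|%R)%:E <= (sigma ^+ 2 / Num.sqrt (2 * M%:R))%:E)%E.
  apply: (le_trans (integral_quadratic_noise_le hsigma indn n1 n2 v_sigma b hM)).
  rewrite lee_fin.
  have -> : \sum_k b k ^+ 2 = (2 * M%:R)^-1.
    rewrite -(pair_bigA _ (fun m (k : 'I_L * 'I_L) => (M%:R^-1 *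
      (dft_re R f k.1 * dft_re R f k.2 + dft_im R f k.1 * dft_im R f k.2)) ^+ 2))/=.
    rewrite sumr_const card_ord -[LHS]mulr_natl.
    rewrite -(pair_bigA _ (fun s t => (M%:R^-1 *
      (dft_re R f s * dft_re R f t + dft_im R f s * dft_im R f t)) ^+ 2))/=.
    under eq_bigr do under eq_bigr do rewrite exprMn.
    under eq_bigr do rewrite -mulr_sumr.
    rewrite -mulr_sumr sum_sqr_cross ?sum_dft_re_sqr ?sum_dft_im_sqr
      ?sum_dft_re_im//.
    by field; rewrite gt_eqF.
  rewrite [leLHS]sqrtrM ?exprn_ge0// sqrtrV ?mulr_ge0 ?(ltW M_gt0)//.
  by rewrite (exprM sigma 2 2) sqrtr_sqr ger0_norm// sqr_ge0.
rewrite unlock leeBlDr//.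
apply: (@le_trans _ _
  (\int[P]_w ((cmod X ^+ 2)%:E + ((`|lin w|)%:E + (`|quad w|)%:E)))%E).
  apply: ge0_le_integral => //.
  - apply/measurable_EFinP; under eq_fun do rewrite PE.
    apply: measurableT_comp => //; apply: measurable_funD => //.
    exact: measurable_funD.
  - apply: emeasurable_funD => //; apply: emeasurable_funD => //;
      by apply/measurable_EFinP; exact: measurableT_comp.
  - move=> w _; rewrite PE -!EFinD lee_fin addrA.
    apply: (le_trans (ler_normD _ _)); rewrite lerD2r.
    by apply: (le_trans (ler_normD _ _)); rewrite lerD2r ger0_norm// sqr_ge0.
rewrite ge0_integralD//; last 3 first.
- by move=> w _; rewrite lee_fin sqr_ge0.
- by move=> w _; rewrite adde_ge0.
- by apply: emeasurable_funD; apply/measurable_EFinP; exact: measurableT_comp.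
rewrite integral_cst//= probability_setT mule1 addeC leeD2r//.
rewrite ge0_integralD//; last 2 first.
- by apply/measurable_EFinP; exact: measurableT_comp.
- by apply/measurable_EFinP; exact: measurableT_comp.
by rewrite EFinD; exact: leeD.
Qed.
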